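(* For every positive integer $n$, $$\frac{B_n^{\pm}(t)}{(1-t)^{n+1}}=\frac{\mathrm{BExc}_n^{\pm}(t)}{(1-t)^{n+1}}=\sum_{k\ge 0}\frac{(2k+1)^n\pm 1}{2}\,t^k,$$ with the same choice of sign throughout, as formal power series.
   Context: $\mathfrak{B}_n$ is the group of signed permutations of $\{\pm1,\dots,\pm n\}$, written $\pi=\pi_1\cdots\pi_n$ with $\pi_i=\pi(i)$. $\mathrm{negs}(\pi)=|\{i:\pi_i<0\}|$, $\mathrm{inv}_B(\pi)=|\{i<j:\pi_i>\pi_j\}|+|\{i<j:-\pi_i>\pi_j\}|+\mathrm{negs}(\pi)$; $\mathfrak{B}_n^{+}$ (resp. $\mathfrak{B}_n^-$) is the set of $\pi$ with $\mathrm{inv}_B(\pi)$ even (resp. odd). With $\pi_0=0$, $\mathrm{des}_B(\pi)=|\{i\in\{0,\dots,n-1\}:\pi_i>\pi_{i+1}\}|$; $\mathrm{exc}_B(\pi)=|\{i\in[n]:\pi_{|\pi_i|}>\pi_i\}\cup\{i\in[n]:\pi_i=-i\}|$. $B_n^{\pm}(t)=\sum_{\pi\in\mathfrak{B}_n^{\pm}}t^{\mathrm{des}_B(\pi)}$ and $\mathrm{BExc}_n^{\pm}(t)=\sum_{\pi\in\mathfrak{B}_n^{\pm}}t^{\mathrm{exc}_B(\pi)}$. *)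

(* Defs.v *)
From mathcomp Require Import all_boot all_order all_algebra all_fingroup.

Set Implicit Arguments.
Unset Strict Implicit.
Unset Printing Implicit Defensive.
Import Order.TTheory GRing.Theory Num.Theory.
Local Open Scope ring_scope.

(* The set {±1, ..., ±n}: the pair (s, i), with 0 <= i < n, stands for i + 1
   when s = false and for -(i + 1) when s = true. *)
Notation letter n := (bool * 'I_n)%type.

Definition letter_val n (x : letter n) : int := (-1) ^+ x.1 * (x.2.+1)%:Z.
Definition letter_opp n (x : letter n) : letter n := (~~ x.1, x.2).

Lemma letter_val_opp n (x : letter n) :
  letter_val (letter_opp x) = - letter_val x.
Proof.
case: x => -[] i; rewrite /letter_val /= !(expr0, expr1).
  by rewrite mulN1r mul1r opprK.
by rewrite mulN1r mul1r.
Qed.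

Lemma letter_val_inj n : injective (@letter_val n).
Proof.
move=> [[] i] [[] j]; rewrite /letter_val /= !(expr0, expr1) ?mulN1r ?mul1r //.
- by move/oppr_inj => -[] /val_inj ->.
- by case=> /val_inj ->.
Qed.

Definition signed_perms n : {set {perm letter n}} :=
  [set p : {perm letter n} |
    [forall x, p (letter_opp x) == letter_opp (p x)]].

Lemma signed_perms_group_set n : group_set (signed_perms n).
Proof.
apply/group_setP; split=> [|p q].
  by rewrite inE; apply/forallP=> x; rewrite !perm1.
rewrite !inE => /forallP hp /forallP hq; apply/forallP=> x.
by rewrite !permM (eqP (hp x)) (eqP (hq _)).
Qed.
Canonical signed_perms_group n := Group (signed_perms_group_set n).

(* entry p i is p_i = p(i) for 1 <= i <= n, and p_0 = 0; the value for i > n is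
   junk and never used. *)
Definition entry n (p : {perm letter n}) (i : nat) : int :=
  if i is j.+1 then
    if insub j is Some k then letter_val (p (false, k)) else 0
  else 0.

(* In the statistics below, k : 'I_n stands for the position k + 1 in [n],
   except in desB, where it ranges over {0, ..., n - 1} itself. *)
Definition negs n (p : {perm letter n}) : nat :=
  #|[set i : 'I_n | entry p i.+1 < 0]|.

Definition invB n (p : {perm letter n}) : nat :=
  (#|[set ij : 'I_n * 'I_n |
       (ij.1 < ij.2)%N && (entry p ij.1.+1 > entry p ij.2.+1)%R]|
   + #|[set ij : 'I_n * 'I_n |
       (ij.1 < ij.2)%N && (- entry p ij.1.+1 > entry p ij.2.+1)%R]|
   + negs p)%N.

Definition desB n (p : {perm letter n}) : nat :=
  #|[set i : 'I_n | entry p i > entry p i.+1]|.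

Definition excB n (p : {perm letter n}) : nat :=
  #|[set i : 'I_n | entry p `|entry p i.+1|%N > entry p i.+1]
    :|: [set i : 'I_n | entry p i.+1 == - (i.+1)%:Z]|.

(* The sign ± is encoded by s : bool, with s = false for + (invB even) and
   s = true for - (invB odd). *)
Definition signed_perms_sgn (n : nat) (s : bool) : {set {perm letter n}} :=
  [set p in signed_perms n | odd (invB p) == s].

Definition Bpoly (n : nat) (s : bool) : {poly rat} :=
  \sum_(p in signed_perms_sgn n s) 'X^(desB p).

Definition BExc (n : nat) (s : bool) : {poly rat} :=
  \sum_(p in signed_perms_sgn n s) 'X^(excB p).

(* Formal power series, as coefficient sequences compared with =1. *)
Definition fps (R : Type) : Type := nat -> R.

Definition fps_of_poly (R : nzSemiRingType) (p : {poly R}) : fps R :=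
  fun k => p`_k.

Definition fps_mul (R : nzSemiRingType) (f g : fps R) : fps R :=
  fun k => \sum_(i < k.+1) f i * g (k - i)%N.

(* fps_inv_seq f k = [:: g_k; ...; g_0] with g the inverse of f, from
   g_0 = 1 / f_0 and g_(k+1) = - (1 / f_0) \sum_(i <= k) f_(i+1) g_(k-i). *)
Fixpoint fps_inv_seq (F : fieldType) (f : fps F) (k : nat) : seq F :=
  if k is j.+1 then
    let g := fps_inv_seq f j in
    - (f 0%N)^-1 * (\sum_(i < k) f i.+1 * g`_i) :: g
  else [:: (f 0%N)^-1].

Definition fps_inv (F : fieldType) (f : fps F) : fps F :=
  fun k => (fps_inv_seq f k)`_0.

Definition fps_div (F : fieldType) (f g : fps F) : fps F :=
  fps_mul f (fps_inv g).

Lemma fps_inv_seqE (F : fieldType) (f : fps F) k i :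
  (i <= k)%N -> (fps_inv_seq f k)`_i = fps_inv f (k - i)%N.
Proof.
elim: k i => [|k IHk] [|i] //= le_ik.
by rewrite IHk // subSS.
Qed.

Lemma fps_mulV (F : fieldType) (f : fps F) :
  f 0%N != 0 -> fps_mul f (fps_inv f) =1 fps_of_poly 1.
Proof.
move=> f0 [|k]; rewrite /fps_mul /fps_of_poly coef1.
  by rewrite big_ord1 subnn /fps_inv /= mulfV.
rewrite big_ord_recl subn0 {1}/fps_inv /= mulrA mulrN mulfV // mulN1r.
apply/eqP; rewrite addrC subr_eq0; apply/eqP; apply: eq_bigr => i _.
by rewrite fps_inv_seqE ?subSS // -ltnS.
Qed.

(* Main.v *)
(* Every signed permutation of [n + 1] letters arises exactly once from one of [n]
   letters by inserting the letter [n + 1], with a sign, either at one of the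
   [n + 1] positions of the word (for descents) or in one of the cycles or as a
   new fixed point (for excedances). Appending it as the last entry, which is the
   same as adding a fixed point, changes the statistic by 0 or 1 according to the
   sign; each of the other [n] insertions leaves it unchanged in [e] cases and adds
   1 in [n - e] cases, [e] being the old value, whatever the sign is. Changing the
   sign of the inserted letter always flips the parity of inv_B. Hence, with
   [T = P_+ + P_-], both pairs of polynomials satisfy
     Q_s = P_s + t P_(-s) + t T' + n t T - t^2 T',
   where [Q_s] is the polynomial for [n + 1] letters and T' is the derivative. This
   gives [P_+ - P_- = (1 - t)^n] and says that [T / (1 - t)^(n+1)] is multiplied
   by the operator [1 + 2 t d/dt] when [n] grows by 1, so that its coefficients
   are [(2 k + 1)^n]. *)
Require Import Defs.
From mathcomp Require Import all_boot all_order all_algebra all_fingroup.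
From mathcomp Require Import zify ring.
Import Order.TTheory GRing.Theory Num.Theory.
Local Open Scope ring_scope.

Set Implicit Arguments.
Unset Strict Implicit.
Unset Printing Implicit Defensive.

#[local] Arguments entry : simpl never.

(** * Signed permutations and the parity of [invB] *)

Lemma card_set_sum (T : finType) (P : pred T) :
  #|[set x | P x]| = (\sum_x P x)%N.
Proof.
by rewrite -sum1dep_card big_mkcond; apply: eq_bigr => x _; case: (P x).
Qed.

Lemma signed_permP n (p : {perm letter n}) :
  reflect (forall b i, p (b, i) = (b (+) (p (false, i)).1, (p (false, i)).2))
          (p \in signed_perms n).
Proof.
rewrite inE; apply: (iffP forallP) => [hp [] i | hp [b i]].
- by rewrite -[(true, i)]/(letter_opp (false, i)) (eqP (hp _)).
- by case: (p _).
- by rewrite /letter_opp /= (hp (~~ b)) (hp b) addNb.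
Qed.

Lemma signed_perm_abs_inj n (p : {perm letter n}) :
  p \in signed_perms n -> injective (fun i => (p (false, i)).2).
Proof.
move=> /signed_permP hp i j eq_abs.
suff /perm_inj []: p (false, i) =
  p ((p (false, i)).1 (+) (p (false, j)).1, j) by [].
by rewrite (hp _ j) -addbA addbb addbF -eq_abs; case: (p _).
Qed.

Lemma entryS n (p : {perm letter n}) (i : 'I_n) :
  entry p i.+1 = letter_val (p (false, i)).
Proof. by rewrite /entry valK. Qed.

Lemma letter_val_false n (i : 'I_n) : letter_val (false, i) = i.+1%:Z.
Proof. by rewrite /letter_val expr0 mul1r. Qed.

Lemma letter_val_true n (i : 'I_n) : letter_val (true, i) = - i.+1%:Z.
Proof. by rewrite /letter_val expr1 mulN1r. Qed.

Definition letter_valE := (letter_val_false, letter_val_true).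

Lemma abs_letter_val n (x : letter n) : `|letter_val x|%N = x.2.+1.
Proof. by case: x => -[] i; rewrite letter_valE ?abszN. Qed.

Lemma letter_val_lt0 n (x : letter n) : (letter_val x < 0) = x.1.
Proof. by case: x => -[] i; rewrite letter_valE /=; lia. Qed.

Lemma odd_sum (I : finType) (F : I -> nat) :
  odd (\sum_i F i) = \big[addb/false]_i odd (F i).
Proof. exact: (big_morph odd oddD). Qed.

(** The inversion number of the underlying permutation of absolute values. *)
Definition abs_inv n (p : {perm letter n}) : nat :=
  (\sum_(i < n) \sum_(j < n)
     ((i < j) && ((p (false, j)).2 < (p (false, i)).2)))%N.

Definition neg_count n (p : {perm letter n}) : nat :=
  (\sum_(i < n) (p (false, i)).1)%N.

(* For [|x| != |y|], exactly one of [x > y], [-x > y] holds if [|x| > |y|], and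
   both or none otherwise. *)
Lemma odd_invB n (p : {perm letter n}) : p \in signed_perms n ->
  odd (invB p) = odd (abs_inv p) (+) odd (neg_count p).
Proof.
move=> sp; rewrite /invB oddD /negs; congr (_ (+) odd _); last first.
  by rewrite card_set_sum; apply: eq_bigr => i _; rewrite entryS letter_val_lt0.
rewrite !card_set_sum -big_split /= odd_sum /abs_inv pair_bigA odd_sum /=.
apply: eq_bigr => -[i j] _ /=; case: ltnP => //= lt_ij.
have neq : (p (false, i)).2 != (p (false, j)).2.
  by apply: contraTneq lt_ij => /(signed_perm_abs_inj sp) ->; rewrite ltnn.
rewrite !entryS; move: neq.
case: (p (false, i)) (p (false, j)) => [bi u] [bj v] /= /eqP neq.
have {}neq : u <> v :> nat by move=> /val_inj.
case: bi; case: bj; rewrite !letter_valE; lia.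
Qed.

Lemma sum_ordD1 n (a : 'I_n.+1) (F : 'I_n.+1 -> nat) :
  (\sum_i F i = F a + \sum_(i < n) F (lift a i))%N.
Proof. exact: bigD1_ord. Qed.

(** * Inserting a letter of maximal absolute value *)

Definition widen_letter n (x : letter n) : letter n.+1 :=
  (x.1, lift ord_max x.2).

Lemma widen_letter_inj n : injective (@widen_letter n).
Proof.
move=> [b i] [c j] eq_xy; congr (_, _); first by case: eq_xy.
by have /(congr1 snd)/lift_inj := eq_xy.
Qed.

Lemma letter_val_widen n (x : letter n) :
  letter_val (widen_letter x) = letter_val x.
Proof. by congr (_ * _.+1%:Z); apply: lift_max. Qed.

Definition ext_fun n (p : {perm letter n}) (x : letter n.+1) : letter n.+1 :=
  if unlift ord_max x.2 is Some j then widen_letter (p (x.1, j)) else x.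

Lemma ext_fun_inj n (p : {perm letter n}) : injective (ext_fun p).
Proof.
move=> [b i] [c j]; rewrite /ext_fun /=.
case: unliftP => [i' ->|->]; case: unliftP => [j' ->|->] //.
- by move/widen_letter_inj/perm_inj => [-> ->].
- by move/(congr1 snd)/eqP; rewrite eq_sym (negPf (neq_lift _ _)).
- by move/(congr1 snd)/eqP; rewrite (negPf (neq_lift _ _)).
Qed.

Definition ext_perm n (p : {perm letter n}) : {perm letter n.+1} :=
  perm (@ext_fun_inj n p).

Lemma ext_perm_max n (p : {perm letter n}) b :
  ext_perm p (b, ord_max) = (b, ord_max).
Proof. by rewrite permE /ext_fun /= unlift_none. Qed.

Lemma ext_perm_widen n (p : {perm letter n}) b i :
  ext_perm p (b, lift ord_max i) = widen_letter (p (b, i)).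
Proof. by rewrite permE /ext_fun /= liftK. Qed.

Lemma ext_perm_inj n : injective (@ext_perm n).
Proof.
move=> p q eq_pq; apply/permP => -[b i]; apply: widen_letter_inj.
by rewrite -!ext_perm_widen eq_pq.
Qed.

Lemma ext_perm_signed n (p : {perm letter n}) :
  p \in signed_perms n -> ext_perm p \in signed_perms n.+1.
Proof.
move=> /signed_permP hp; apply/signed_permP => b i.
case: (unliftP ord_max i) => [j|] ->; last by rewrite !ext_perm_max addbF.
by rewrite !ext_perm_widen /widen_letter hp.
Qed.

Lemma ext_perm_surj n (q : {perm letter n.+1}) : q \in signed_perms n.+1 ->
  q (false, ord_max) = (false, ord_max) ->
  exists2 p, p \in signed_perms n & q = ext_perm p.
Proof.
move=> sq qmax; have /signed_permP hq := sq.
(* The default [x.2] is never reached: [q] fixes the maximal letter, so injectivity on absolute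
   values keeps the other images away from it. *)
pose f (x : letter n) : letter n :=
  let y := q (widen_letter x) in (y.1, odflt x.2 (unlift ord_max y.2)).
have fE x : widen_letter (f x) = q (widen_letter x).
  case: x => b i; rewrite /f /widen_letter /=.
  case: unliftP => [j|] eq_j /=; first by rewrite -eq_j; case: (q _).
  have := neq_lift ord_max i; rewrite -(inj_eq (signed_perm_abs_inj sq)).
  by move: eq_j; rewrite qmax hq /= => ->; rewrite eqxx.
have f_inj : injective f.
  move=> x y eq_f; apply: widen_letter_inj; apply: (@perm_inj _ q).
  by rewrite -!fE eq_f.
exists (perm f_inj).
  apply/signed_permP => b i; rewrite !permE; apply: widen_letter_inj.
  rewrite fE /widen_letter /= hq; congr (_, _).
  by have /(congr1 snd) /= := fE (false, i); rewrite /widen_letter /=.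
apply/permP => -[b i]; case: (unliftP ord_max i) => [j|] ->.
  by rewrite ext_perm_widen permE fE.
by rewrite hq qmax ext_perm_max addbF.
Qed.

(** Moves positions by [t] and flips the sign only at [c.2], and only if [c.1]; thus [c] itself goes
    to the positive letter at [t c.2]. *)
Definition twist_fun m (t : {perm 'I_m}) (c x : letter m) : letter m :=
  (x.1 (+) ((x.2 == c.2) && c.1), t x.2).

Lemma twist_fun_inj m (t : {perm 'I_m}) c : injective (twist_fun t c).
Proof. by move=> [b i] [d j] [/= + /perm_inj eq_ij]; rewrite eq_ij => /addIb ->. Qed.

Definition twist m (t : {perm 'I_m}) (c : letter m) : {perm letter m} :=
  perm (@twist_fun_inj m t c).

Lemma twist_signed m (t : {perm 'I_m}) c : twist t c \in signed_perms m.
Proof. by apply/signed_permP => b i; rewrite !permE. Qed.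

(* [t] sends the position [c.2] to the maximal one; the value there becomes the
   letter [n + 1] with sign [c.1]. *)
Definition insert n (t : {perm 'I_n.+1}) (c : letter n.+1) (p : {perm letter n}) :
  {perm letter n.+1} := (twist t c * ext_perm p)%g.

Lemma insertE n (t : {perm 'I_n.+1}) c (p : {perm letter n}) x :
  insert t c p x = ext_perm p (x.1 (+) ((x.2 == c.2) && c.1), t x.2).
Proof. by rewrite permM [twist _ _ _]permE. Qed.

Lemma insert_signed n (t : {perm 'I_n.+1}) c (p : {perm letter n}) :
  p \in signed_perms n -> insert t c p \in signed_perms n.+1.
Proof. by move=> sp; rewrite groupM ?twist_signed ?ext_perm_signed. Qed.

Lemma insert_at n (t : {perm 'I_n.+1}) b a (p : {perm letter n}) :
  t a = ord_max -> insert t (b, a) p (false, a) = (b, ord_max).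
Proof. by move=> ta; rewrite insertE /= eqxx ta ext_perm_max. Qed.

Lemma insert_lift n (t : {perm 'I_n.+1}) b a (p : {perm letter n}) i j :
  t a = ord_max -> t i = lift ord_max j ->
  insert t (b, a) p (false, i) = widen_letter (p (false, j)).
Proof.
move=> ta ti; rewrite insertE /=.
case: eqVneq => [eq_ia|_]; last by rewrite ti ext_perm_widen.
by have := neq_lift ord_max j; rewrite -ti eq_ia ta eqxx.
Qed.

(* The permutations [twist (t a) (b, a)] form a transversal of the stabilizer of
   the letter [n + 1]. *)
Lemma sum_insert (V : nmodType) n (t : 'I_n.+1 -> {perm 'I_n.+1})
    (F : {perm letter n.+1} -> V) :
  (forall a, t a a = ord_max) ->
  \sum_(q in signed_perms n.+1) F q =
  \sum_(p in signed_perms n) \sum_c F (insert (t c.2) c p).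
Proof.
move=> ta; pose N : letter n.+1 := (false, ord_max).
have tN c (p : {perm letter n}) : insert (t c.2) c p c = N.
  by case: c => b a; rewrite insertE /= eqxx addbb ta ext_perm_max.
(* The classes are indexed by the letter that [q] sends to [N]. *)
rewrite exchange_big /= (partition_big (fun q : {perm _} => (q^-1)%g N) predT) //=.
apply: eq_bigr => c _.
rewrite -(big_imset (h := insert (t c.2) c) F) /=; last first.
  by move=> p1 p2 _ _ /mulgI /ext_perm_inj.
apply: eq_bigl => q; apply/andP/imsetP => [[sq /eqP qN] | [p sp ->]].
  have [||p sp eq_p] := @ext_perm_surj n ((twist (t c.2) c)^-1 * q)%g.
  - by rewrite groupM ?groupV ?twist_signed.
  - have tc : twist (t c.2) c c = N by rewrite permE /twist_fun eqxx addbb ta.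
    by rewrite -/N -{1}tc permM permK -qN permKV.
  by exists p; rewrite // /insert -eq_p mulKVg.
by rewrite insert_signed //; split=> //; rewrite -(tN c p) permK.
Qed.

(** * Parity of [invB] under insertion *)

Lemma abs_inv_insert n (t : {perm 'I_n.+1}) b a (p : {perm letter n}) :
  p \in signed_perms n ->
  abs_inv (insert t (b, a) p) = abs_inv (insert t (false, a) p).
Proof.
move=> sp; have /signed_permP hp := ext_perm_signed sp.
suff eq2 i : (insert t (b, a) p (false, i)).2 = (insert t (false, a) p (false, i)).2.
  by apply: eq_bigr => i _; apply: eq_bigr => j _; rewrite !eq2.
by rewrite !insertE /= andbF [in RHS]hp hp.
Qed.

Lemma neg_count_insert n (t : {perm 'I_n.+1}) b a (p : {perm letter n}) :
  t a = ord_max -> neg_count (insert t (b, a) p) = (b + neg_count p)%N.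
Proof.
move=> ta; rewrite /neg_count (reindex_inj (@perm_inj _ t^-1%g)) /=.
have tV : (t^-1)%g ord_max = a by rewrite -ta permK.
rewrite (sum_ordD1 ord_max) tV insert_at //=; congr (_ + _)%N.
by apply: eq_bigr => i _; rewrite (@insert_lift _ _ _ _ _ _ i) ?permKV.
Qed.

Lemma odd_invB_insert n (t : {perm 'I_n.+1}) b a (p : {perm letter n}) :
  p \in signed_perms n -> t a = ord_max ->
  odd (invB (insert t (b, a) p)) = b (+) odd (invB (insert t (false, a) p)).
Proof.
move=> sp ta; rewrite !odd_invB ?insert_signed // !neg_count_insert //.
by rewrite abs_inv_insert // !oddD oddb addFb addbCA.
Qed.

(** A maximal letter in last position creates no inversion of absolute values, so only its sign
    counts. *)
Lemma odd_invB_insert_max n b (p : {perm letter n}) :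
  p \in signed_perms n ->
  odd (invB (insert 1%g (b, ord_max) p)) = b (+) odd (invB p).
Proof.
move=> sp; have t1 : (1%g : {perm 'I_n.+1}) ord_max = ord_max by rewrite perm1.
rewrite !odd_invB ?insert_signed // !neg_count_insert //.
rewrite oddD oddb addbCA; congr (b (+) (odd _ (+) _)).
have insL i : insert 1 (b, ord_max) p (false, lift ord_max i) =
    widen_letter (p (false, i)) by rewrite (@insert_lift _ _ _ _ _ _ i) ?perm1.
rewrite /abs_inv (sum_ordD1 ord_max) big1 ?add0n => [|j _]; last first.
  by rewrite /= ltnNge -ltnS ltn_ord.
apply: eq_bigr => i _; rewrite (sum_ordD1 ord_max) insert_at // insL.
rewrite [X in ((_ && X) + _)%N]ltnNge leq_ord andbF add0n.
by apply: eq_bigr => j _; rewrite insL !lift_max.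
Qed.

(** * Descents and excedances under insertion *)

(** The new place contributes [b] and the place [i0] now contributes [~~ b]: together 1, whatever
    [b] is, instead of the former [f i0]. *)
Lemma sum_switch n (f g : 'I_n -> bool) i0 b :
  g i0 = ~~ b -> (forall i, i != i0 -> g i = f i) ->
  (b + \sum_i g i = \sum_i f i + ~~ f i0)%N.
Proof.
move=> gi0 eq_gf; rewrite (bigD1 i0) //= [in RHS](bigD1 i0) //= gi0.
rewrite (eq_bigr (fun i => f i : nat)) => [|i /eq_gf -> //].
by case: b {gi0}; case: (f i0); lia.
Qed.

Lemma letter_val_max_lt n b (z : int) : (`|z| <= n)%N ->
  (@letter_val n.+1 (b, ord_max) < z) = b.
Proof. by case: b; rewrite letter_valE /=; lia. Qed.

Lemma lt_letter_val_max n b (z : int) : (`|z| <= n)%N ->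
  (z < @letter_val n.+1 (b, ord_max)) = ~~ b.
Proof. by case: b; rewrite letter_valE /=; lia. Qed.

Lemma abs_entry n (p : {perm letter n}) i : (`|entry p i| <= n)%N.
Proof.
case: i => [|i] //; rewrite /entry; case: insubP => // k _ _.
by rewrite abs_letter_val.
Qed.

Definition descent n (p : {perm letter n}) (i : 'I_n) : bool :=
  entry p i.+1 < entry p i.

Lemma desBE n (p : {perm letter n}) : desB p = (\sum_i descent p i)%N.
Proof. exact: card_set_sum. Qed.

Section DescentInsertion.

Variables (n : nat) (b : bool) (a : 'I_n.+1) (p : {perm letter n}).

(** [lift_perm a ord_max 1] preserves the order of the positions other than [a], so [q] is the word
    of [p] with the new letter inserted at [a]. *)
Let q := insert (lift_perm a ord_max 1) (b, a) p.

Let ta : lift_perm a ord_max 1 a = ord_max.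
Proof. exact: lift_perm_id. Qed.

Lemma entry_insert_at : entry q a.+1 = @letter_val n.+1 (b, ord_max).
Proof. by rewrite entryS insert_at. Qed.

Lemma entry_insert_lift (i : 'I_n) : entry q (lift a i).+1 = entry p i.+1.
Proof.
rewrite !entryS (@insert_lift _ _ _ _ _ _ i) ?letter_val_widen //.
by rewrite lift_perm_lift perm1.
Qed.

Lemma entry_insert_le k : (k <= a)%N -> entry q k = entry p k.
Proof.
case: k => // k lt_ka.
have lt_kn : (k < n)%N by apply: leq_trans lt_ka _; rewrite -ltnS.
by have := entry_insert_lift (Ordinal lt_kn); rewrite /= /bump leqNgt lt_ka.
Qed.

Lemma entry_insert_gt k : (a < k <= n)%N -> entry q k.+1 = entry p k.
Proof.
case: k => // k /andP[le_ak lt_kn].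
by have := entry_insert_lift (Ordinal lt_kn); rewrite /= /bump -ltnS le_ak.
Qed.

Lemma descent_insert_at : descent q a = b.
Proof.
by rewrite /descent entry_insert_at entry_insert_le // letter_val_max_lt ?abs_entry.
Qed.

Lemma descent_insert_lift (i : 'I_n) :
  descent q (lift a i) = if i == a :> nat then ~~ b else descent p i.
Proof.
rewrite /descent entry_insert_lift /= /bump; case: ltngtP => [lt_ai|lt_ia|eq_ai].
- by rewrite add1n entry_insert_gt // lt_ai ltnW.
- by rewrite add0n (entry_insert_le (ltnW lt_ia)).
- by rewrite add1n -eq_ai entry_insert_at lt_letter_val_max ?abs_entry.
Qed.

End DescentInsertion.

(** A maximal letter placed inside a gap of the word makes one ascent and one descent there, in an
    order fixed by its sign, so the gap always ends up with exactly one descent. *)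
Lemma desB_insert n b (i : 'I_n) (p : {perm letter n}) :
  let a := lift ord_max i in
  desB (insert (lift_perm a ord_max 1) (b, a) p) = (desB p + ~~ descent p i)%N.
Proof.
move=> a; rewrite !desBE (sum_ordD1 a) descent_insert_at.
apply: sum_switch => [|j ne_ji]; rewrite descent_insert_lift lift_max ?eqxx //.
by rewrite (inj_eq val_inj) (negPf ne_ji).
Qed.

Lemma desB_insert_max n b (p : {perm letter n}) :
  desB (insert 1 (b, ord_max) p) = (desB p + b)%N.
Proof.
rewrite -(lift_perm1 ord_max) !desBE (sum_ordD1 ord_max) descent_insert_at addnC.
congr (_ + _)%N; apply: eq_bigr => i _.
by rewrite descent_insert_lift ltn_eqF.
Qed.

Definition excedance n (p : {perm letter n}) (i : 'I_n) : bool :=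
  let x := p (false, i) in
  (letter_val x < letter_val (p (false, x.2))) || (x == (true, i)).

Lemma excBE n (p : {perm letter n}) : excB p = (\sum_i excedance p i)%N.
Proof.
rewrite -card_set_sum; congr #|pred_of_set _|; apply/setP => i.
rewrite !inE entryS abs_letter_val entryS -letter_val_true.
by rewrite (inj_eq (@letter_val_inj n)).
Qed.

Lemma widen_letter_neq_max n (x : letter n) b :
  (widen_letter x == (b, ord_max)) = false.
Proof.
apply/eqP => /(congr1 snd)/eqP; rewrite eq_sym.
by rewrite (negPf (neq_lift _ _)).
Qed.

(* The letter [n + 1] is inserted in a cycle of [p], between the value at position
   [i] and its successor. *)
Lemma excB_insert n b (i : 'I_n) (p : {perm letter n}) : p \in signed_perms n ->
  let a := lift ord_max (p (false, i)).2 in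
  excB (insert (tperm a ord_max) (b, a) p) = (excB p + ~~ excedance p i)%N.
Proof.
move=> sp a; set t := tperm a ord_max; set q := insert _ _ _.
have ta : t a = ord_max by rewrite tpermL.
have q_at : q (false, a) = (b, ord_max) by rewrite insert_at.
have q_t j : q (false, t (lift ord_max j)) = widen_letter (p (false, j)).
  by rewrite (@insert_lift _ _ _ _ _ _ j) // tpermK.
have t_lift j : j != (p (false, i)).2 -> t (lift ord_max j) = lift ord_max j.
  move=> ne_j; rewrite tpermD ?neq_lift // eq_sym.
  by rewrite (inj_eq (@lift_inj _ _)).
have abs_val j : (`|letter_val (p (false, j))| <= n)%N by rewrite abs_letter_val.
rewrite !excBE (reindex_inj (@perm_inj _ t)) (sum_ordD1 ord_max) /=.
have -> : excedance q (t ord_max) = b.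
  rewrite tpermR /excedance q_at -[(b, ord_max).2]ta q_t letter_val_widen.
  by rewrite letter_val_max_lt // xpair_eqE (negPf (neq_lift _ _)) andbF orbF.
apply: sum_switch => [|j ne_ji]; rewrite /excedance q_t letter_val_widen.
  (* The value of absolute value [a] is now followed by the new letter, so the sign of the latter
     alone decides the comparison. *)
  rewrite -/a q_at lt_letter_val_max //.
  rewrite (_ : _ == _ = false) ?orbF //.
  apply/eqP => /(congr1 (fun x => t x.2))/eqP.
  by rewrite tpermK -/a ta (negPf (neq_lift _ _)).
rewrite (_ : (widen_letter _).2 = t (lift ord_max (p (false, j)).2)); last first.
  by rewrite t_lift // (inj_eq (signed_perm_abs_inj sp)).
rewrite q_t letter_val_widen; congr (_ || _).
have [eq_j|ne_j] := eqVneq j (p (false, i)).2.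
  (* Position [j] has moved to the maximal one. There [p] cannot send [j] to its opposite: the
     values at [i] and [j] would have equal absolute values, forcing [j = i]. *)
  rewrite {2}eq_j -/a ta widen_letter_neq_max; apply/esym/eqP => pj.
  move: ne_ji; rewrite -(inj_eq (signed_perm_abs_inj sp)) pj /= {1}eq_j eqxx //.
rewrite t_lift // -[(true, lift _ _)]/(widen_letter (true, j)).
by rewrite (inj_eq (@widen_letter_inj _)).
Qed.

Lemma excB_insert_max n b (p : {perm letter n}) :
  excB (insert 1 (b, ord_max) p) = (excB p + b)%N.
Proof.
set q := insert _ _ _.
have q_at : q (false, ord_max) = (b, ord_max) by rewrite insert_at ?perm1.
have q_lift j : q (false, lift ord_max j) = widen_letter (p (false, j)).
  by rewrite (@insert_lift _ _ _ _ _ _ j) ?perm1.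
rewrite !excBE (sum_ordD1 ord_max) addnC; congr (_ + _)%N; last first.
  by rewrite /excedance q_at /= q_at ltxx xpair_eqE eqxx andbT eqb_id.
apply: eq_bigr => i _; rewrite /excedance q_lift q_lift !letter_val_widen.
rewrite -[(true, lift _ _)]/(widen_letter (true, i)).
by rewrite (inj_eq (@widen_letter_inj _)).
Qed.

(* The common behaviour of [desB] and [excB] under insertion: [D] marks the [f p]
   places where an insertion leaves [f] unchanged, and [k] matches places with
   positions of the new letter. *)
Definition inserts (f : forall n, {perm letter n} -> nat) : Prop :=
  forall n, exists t : 'I_n.+1 -> {perm 'I_n.+1},
  [/\ forall a, t a a = ord_max, t ord_max = 1%g
    & forall p, p \in signed_perms n ->
      (forall b, f _ (insert 1 (b, ord_max) p) = (f n p + b)%N) /\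
      exists (D : pred 'I_n) (k : 'I_n -> 'I_n),
        [/\ f n p = (\sum_i D i)%N, injective k
          & forall b i, let a := lift ord_max (k i) in
            f _ (insert (t a) (b, a) p) = (f n p + ~~ D i)%N]].

Lemma desB_inserts : inserts desB.
Proof.
move=> n; exists (fun a => lift_perm a ord_max 1).
split=> [a||p sp]; [exact: lift_perm_id | exact: lift_perm1 |].
split=> [b|]; first exact: desB_insert_max.
exists (descent p), id; split=> // [|b i a]; first exact: desBE.
exact: desB_insert.
Qed.

Lemma excB_inserts : inserts excB.
Proof.
move=> n; exists (fun a => tperm a ord_max).
split=> [a||p sp]; [exact: tpermL | exact: tperm1 |].
split=> [b|]; first exact: excB_insert_max.
exists (excedance p), (fun i => (p (false, i)).2).
split=> [||b i a]; [exact: excBE | exact: signed_perm_abs_inj |].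
exact: excB_insert.
Qed.

(** * Recurrences for the generating polynomials *)

Definition stat_poly (f : forall n, {perm letter n} -> nat) n s : {poly rat} :=
  \sum_(p in signed_perms_sgn n s) 'X^(f n p).

Lemma stat_polyE f n s : stat_poly f n s =
  \sum_(p in signed_perms n) if odd (invB p) == s then 'X^(f n p) else 0.
Proof. by rewrite -big_mkcondr; apply: eq_bigl => p; rewrite inE. Qed.

Definition stat_total f n : {poly rat} := stat_poly f n false + stat_poly f n true.

Lemma stat_totalE f n : stat_total f n = \sum_(p in signed_perms n) 'X^(f n p).
Proof.
rewrite /stat_total !stat_polyE -big_split; apply: eq_bigr => p _ /=.
by case: (odd _); rewrite ?addr0 ?add0r.
Qed.

(** Writing [e 'X^e] as ['X] times a derivative makes the right side linear in ['X^e], so that it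
    can be summed over permutations. *)
Lemma sum_expr_pred n (D : pred 'I_n) (e : nat) : e = (\sum_i D i)%N ->
  \sum_i 'X^(e + ~~ D i) =
  'X * ('X^e)^`() + 'X *+ n * 'X^e - 'X^2 * ('X^e)^`() :> {poly rat}.
Proof.
move=> eE; have XD : 'X * ('X^e)^`() = 'X^e *+ e :> {poly rat}.
  by rewrite derivXn mulrnAr -exprS; case: (e).
transitivity (\sum_i ('X^e *+ D i + 'X * 'X^e - 'X * ('X^e *+ D i)) : {poly rat}).
  apply: eq_bigr => i _; case: (D i); rewrite /= ?addn0 ?addn1 ?exprS; ring.
rewrite sumrB big_split /= -!mulr_sumr sumrMnr -eE sumr_const card_ord.
by rewrite expr2 -[_ * _ * _^`()]mulrA XD mulrnAr mulrnAl.
Qed.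

(* For each position other than the last one, exactly one of the two signs of the
   inserted letter gives the parity [s]. *)
Lemma stat_poly_rec f n s : inserts f ->
  stat_poly f n.+1 s = stat_poly f n s + 'X * stat_poly f n (~~ s)
    + ('X * (stat_total f n)^`() + 'X *+ n * stat_total f n
       - 'X^2 * (stat_total f n)^`()).
Proof.
move=> /(_ n) [t [ta t1 ft]]; rewrite !stat_polyE (sum_insert _ ta).
rewrite stat_totalE raddf_sum /= !mulr_sumr -!big_split /= -sumrB -big_split.
apply: eq_bigr => p sp; have [fmax [D [k [eD k_inj fk]]]] := ft p sp.
pose F b a : {poly rat} :=
  let q := insert (t a) (b, a) p in
  if odd (invB q) == s then 'X^(f _ q) else 0.
rewrite (eq_bigr (fun c => F c.1 c.2)) => [|[] //]; rewrite -(pair_bigA _ F) /=.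
rewrite exchange_big /= (@bigD1_ord _ _ _ _ ord_max) //= big_bool /F t1 {F}.
rewrite (reindex_inj k_inj) /= -(sum_expr_pred eD); congr (_ + _).
  rewrite !fmax !odd_invB_insert_max // addTb addFb addn0 addn1 exprS addrC.
  by case: (odd _); case: s => /=; rewrite ?mulr0.
apply: eq_bigr => i _; rewrite big_bool !fk odd_invB_insert //.
by case: (odd _); case: s; rewrite /= ?addr0 ?add0r.
Qed.

Lemma stat_poly0 f s : inserts f -> stat_poly f 0 s = (s == false)%:R.
Proof.
move=> /(_ 0%N) [t [_ _ ft]]; rewrite stat_polyE.
have all1 (p : {perm letter 0}) : p = 1%g by apply/permP => -[b []].
have s1 : (1%g : {perm letter 0}) \in signed_perms 0 by apply: group1.
rewrite (big_pred1 1%g) => [|p]; last by rewrite (all1 p) s1 /= eqxx.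
(* [inserts] forces the value 0 on the empty permutation, as a sum over ['I_0]. *)
have [_ [D [k [-> _ _]]]] := ft _ s1; rewrite big_ord0 expr0.
rewrite odd_invB // /abs_inv /neg_count !big_ord0.
by case: s.
Qed.

(** The bracket in [stat_poly_rec] does not depend on [s] and cancels, leaving a factor [1 - 'X] at
    each step. *)
Lemma stat_poly_diff f n : inserts f ->
  stat_poly f n false - stat_poly f n true = (1 - 'X) ^+ n.
Proof.
move=> insf; elim: n => [|n IHn]; first by rewrite !stat_poly0 // subr0.
by rewrite !stat_poly_rec // [in RHS]exprS -IHn /=; ring.
Qed.

Lemma stat_total_rec f n : inserts f ->
  stat_total f n.+1 = (1 + 'X) * stat_total f n
    + ('X * (stat_total f n)^`() + 'X *+ n * stat_total f n
       - 'X^2 * (stat_total f n)^`()) *+ 2.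
Proof.
move=> insf; rewrite {1}/stat_total !stat_poly_rec //=.
set U := (_ - _); rewrite /stat_total; ring.
Qed.

(** * Generating functions *)

(* Power series are handled through their truncations modulo [X^K]. *)
Definition odd_powers n K : {poly rat} := \poly_(k < K) (2 * k%:R + 1) ^+ n.

(** The operator [1 + 2 'X d/d'X] multiplies the coefficient of ['X^k] by [2 k + 1]. *)
Lemma odd_powersS n K :
  odd_powers n.+1 K = odd_powers n K + ('X * (odd_powers n K)^`()) *+ 2.
Proof.
apply/polyP => k; rewrite coefD coefMn coefXM coef_deriv !coef_poly.
case: k => [|k] /=; first by case: ifP => // _; rewrite exprS; ring.
by case: ifP => _; rewrite ?exprS; ring.
Qed.

Lemma geometric_poly K : (1 - 'X) * odd_powers 0 K = 1 - 'X^K :> {poly rat}.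
Proof.
rewrite /odd_powers poly_def -opprB mulNr -(opprB _ 1) subrX1; congr (- (_ * _)).
by apply: eq_bigr => i _; rewrite expr0 scale1r.
Qed.

(** The congruence survives the recurrence because each derivative there carries a factor ['X], and
    ['X d/d'X] preserves multiples of ['X^K]. *)
Lemma dvd_stat_total f n K : inserts f ->
  'X^K %| stat_total f n - (1 - 'X) ^+ n.+1 * odd_powers n K.
Proof.
move=> insf; elim: n => [|n /dvdpP [R]].
  rewrite expr1 geometric_poly /stat_total !stat_poly0 // addr0.
  by rewrite subKr dvdpp.
move/(canRL (subrK _)) => eqT.
have XD : 'X * (stat_total f n)^`() =
    (R^`() * 'X + R *+ K) * 'X^K
    + ('X * (1 - 'X) ^+ n.+1 * (odd_powers n K)^`()
       - ('X * (1 - 'X) ^+ n * odd_powers n K) *+ n.+1).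
  rewrite eqT derivD !derivM derivXn deriv_exp derivB derivX -polyC1 derivC /=.
  have XK : 'X * 'X^(K.-1) *+ K = 'X^K *+ K :> {poly rat}.
    by rewrite -exprS; case: (K).
  transitivity (R^`() * 'X * 'X^K + R * ('X * 'X^(K.-1) *+ K)
    + ('X * (1 - 'X) ^+ n.+1 * (odd_powers n K)^`()
       - ('X * (1 - 'X) ^+ n * odd_powers n K) *+ n.+1)); first by ring.
  by rewrite XK; ring.
(* The witness is the recurrence applied to [R * 'X^K], divided by ['X^K]. *)
apply/dvdpP; exists ((1 + 'X) * R + ((1 - 'X) * (R^`() * 'X + R *+ K)) *+ 2
  + ('X *+ n * R) *+ 2).
rewrite stat_total_rec // expr2 -[_ * _ * _^`()]mulrA XD eqT odd_powersS !exprS.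
ring.
Qed.

(** Half of the total plus or minus the difference [(1 - 'X) ^+ n]; the latter is [(1 - 'X) ^+ n.+1]
    times the geometric series, which yields the constant [(-1) ^+ s]. *)
Lemma dvd_stat_poly f n s K : inserts f ->
  'X^K %| stat_poly f n s
          - (1 - 'X) ^+ n.+1 * \poly_(k < K) (((2 * k%:R + 1) ^+ n + (-1) ^+ s) / 2).
Proof.
move=> insf; set F := \poly_(k < K) _.
have -> : F = 2^-1 *: (odd_powers n K + (-1) ^+ s *: odd_powers 0 K).
  apply/polyP => k; rewrite coefZ coefD coefZ !coef_poly.
  by case: ifP => _; rewrite ?mulr0 ?addr0 ?mulr0 // expr0 mulr1 mulrC.
clear F.
have -> : stat_poly f n s =
    2^-1 *: (stat_total f n + (-1) ^+ s *: (1 - 'X) ^+ n).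
  rewrite -(stat_poly_diff n insf) /stat_total.
  have half (P : {poly rat}) : P = 2^-1 *: (P *+ 2).
    by rewrite -scaler_nat scalerA mulVf // scale1r.
  rewrite [LHS]half; congr (_ *: _).
  by case: s; rewrite /= ?expr0 ?expr1 ?scaleN1r ?scale1r; ring.
rewrite -scalerAr -scalerBr dvdpZr ?invr_eq0 // mulrDr opprD addrACA.
rewrite dvdp_add ?dvd_stat_total // -scalerAr -scalerBr dvdpZr ?signr_eq0 //.
by rewrite exprSr -mulrA geometric_poly mulrBr mulr1 subKr dvdp_mull.
Qed.

(** Coefficient [k] of a product only involves coefficients up to [k], so the inverse series can be
    truncated and the computation done with polynomials. *)
Lemma fps_div_unique (F : fieldType) (P Q : {poly F}) (f : fps F) :
  Q`_0 != 0 -> (forall K, 'X^K %| P - Q * \poly_(k < K) f k) ->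
  fps_div (fps_of_poly P) (fps_of_poly Q) =1 f.
Proof.
move=> Q0 dvdP k; pose h := fps_inv (fps_of_poly Q).
pose H := \poly_(i < k.+1) h i; pose G := \poly_(i < k.+1) f i.
have mulH (A : {poly F}) j : (j <= k)%N -> fps_mul (fps_of_poly A) h j = (A * H)`_j.
  move=> le_jk; rewrite coefM; apply: eq_bigr => i _.
  by rewrite coef_poly ltnS (leq_trans (leq_subr _ _) le_jk).
rewrite /fps_div -/h mulH //.
have /dvdpP [R /(canRL (subrK _)) ->] := dvdP k.+1.
rewrite mulrDl -mulrA mulrCA mulrC coefD coefMXn ltnSn add0r.
(* [Q * H] agrees with 1 up to degree [k]. *)
have -> : (Q * G * H)`_k = (G * 1)`_k.
  rewrite mulrAC mulrC !coefM; apply: eq_bigr => i _; rewrite -mulH ?leq_subr //.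
  by rewrite fps_mulV.
by rewrite mulr1 coef_poly ltnSn.
Qed.

Lemma fps_div_stat_poly f n s : inserts f ->
  fps_div (fps_of_poly (stat_poly f n s)) (fps_of_poly ((1 - 'X) ^+ n.+1))
    =1 (fun k : nat => ((2 * k%:R + 1) ^+ n + (-1) ^+ s) / 2).
Proof.
move=> insf; apply: fps_div_unique => [|K]; last exact: dvd_stat_poly.
by rewrite -horner_coef0 !hornerE expr1n oner_eq0.
Qed.

Theorem theorem6p2 (n : nat) (s : bool) (n_gt0 : (0 < n)%N) :
  (fps_div (fps_of_poly (Bpoly n s)) (fps_of_poly ((1 - 'X) ^+ n.+1))
     =1 fps_div (fps_of_poly (BExc n s)) (fps_of_poly ((1 - 'X) ^+ n.+1)))
  /\ (fps_div (fps_of_poly (BExc n s)) (fps_of_poly ((1 - 'X) ^+ n.+1))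
     =1 (fun k : nat => ((2 * k%:R + 1) ^+ n + (-1) ^+ s) / 2)).
Proof.
have desE := fps_div_stat_poly n s desB_inserts.
have excE := fps_div_stat_poly n s excB_inserts.
by split=> // k; rewrite [LHS]desE [RHS]excE.
Qed.
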